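(* Let $B$ be a basis, $E_B=A_B^{-1}D_B$, and let $$r(\lambda)=c_N^T-c_B^T(A_B+\lambda D_B)^{-1}(A_N+\lambda D_N)$$ be the reduced costs of $\mathcal{P}(\lambda)$ for the basis $B$. Once an eigendecomposition (if $E_B$ is diagonalizable) or a Schur decomposition of $E_B$ has been computed, in a preprocessing that does not depend on $\lambda$, $r(\lambda)$ can be computed in $\mathcal{O}(m^2+mn)$ for each new value of $\lambda$ such that $A_B+\lambda D_B$ is invertible.
   Context: Let $A, D \in \mathbb{R}^{m\times n}$, $b\in\mathbb{R}^m$, $c\in\mathbb{R}^n$, and for $\lambda\in\mathbb{R}$ let $\mathcal{P}(\lambda)$ be the linear program $\min\{c^T x : Ax+\lambda Dx=b,\ x\ge 0\}$. A basis $B$ is a choice of $m$ column indices such that $A_B$ is invertible; for a matrix $M$ with $n$ columns (or a vector with $n$ entries), $M_B$ (resp. $M_N$) is the part formed by the columns (entries) in $B$ (resp. not in $B$). An eigendecomposition is $E_B=Q\Sigma Q^{-1}$ with $\Sigma$ diagonal; a Schur decomposition is $E_B=QUQ^H$ with $Q$ unitary and $U$ upper triangular (both over $\mathbb{C}$). Complexity is the number of arithmetic operations over $\mathbb{C}$ (unit cost); the factors of the decomposition, $A_B^{-1}$ (or an LU decomposition of $A_B$), and any other quantity not depending on $\lambda$ may be computed once in the preprocessing, whose cost is not counted in the per-$\lambda$ cost. *)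

(* Defs.v *)
(* MathComp, over an abstract [R : realType]; [R[i]] is its complex
   closure. *)
From mathcomp Require Import all_boot all_order all_algebra.
From mathcomp Require Import reals.
From mathcomp Require Import complex.

Set Implicit Arguments.
Unset Strict Implicit.
Unset Printing Implicit Defensive.

Import GRing.Theory Num.Theory.
Local Open Scope ring_scope.
Local Open Scope complex_scope.
Local Open Scope sesquilinear_scope.

(* Arithmetic complexity is measured on straight-line programs: the memory is
   a sequence of field elements, initially the input; each instruction costs
   one and appends its result to the memory, its operands being addressed by
   their position.  The only constants available are integers, so a program
   cannot hide problem data. *)
Inductive arith_op := OAdd | OSub | OMul | ODiv.

Inductive instr :=
  | Const of int
  | Arith of arith_op & nat & nat.

Record slp := Slp { code : seq instr; outputs : seq nat }.

Definition cost (P : slp) : nat := size (code P).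

Section Semantics.
Variable F : fieldType.

(* [None] stands for a failed execution; dividing by zero is a failure,
   although [x / 0] is a total expression in the library. *)
Definition eval_op (o : arith_op) (x y : F) : option F :=
  match o with
  | OAdd => Some (x + y)
  | OSub => Some (x - y)
  | OMul => Some (x * y)
  | ODiv => if y == 0 then None else Some (x / y)
  end.

Definition step (mem : seq F) (i : instr) : option (seq F) :=
  match i with
  | Const z => Some (rcons mem z%:~R)
  | Arith o j k =>
      if (j < size mem)%N && (k < size mem)%N
      then omap (rcons mem) (eval_op o mem`_j mem`_k)
      else None
  end.

Definition exec (p : seq instr) (mem : seq F) : option (seq F) :=
  foldl (fun om i => obind (fun mem' => step mem' i) om) (Some mem) p.

Definition run (P : slp) (inp : seq F) : option (seq F) :=
  obind (fun mem => if all (fun k => (k < size mem)%N) (outputs P)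
                    then Some [seq mem`_k | k <- outputs P] else None)
        (exec (code P) inp).

End Semantics.

Definition entries (T : Type) (p q : nat) (M : 'M[T]_(p, q)) : seq T :=
  [seq M i j | i <- enum 'I_p, j <- enum 'I_q].

Section LinearProgram.
Variables (m n : nat) (B : {set 'I_n}) (hB : #|B| = m).

(* The [i]-th smallest index in [B]. *)
Definition bidx (i : 'I_m) : 'I_n := enum_val (cast_ord (esym hB) i).

Definition nidx (j : 'I_#|~: B|) : 'I_n := enum_val j.

Definition colB (T : Type) p (M : 'M[T]_(p, n)) : 'M[T]_(p, m) :=
  colsub bidx M.

Definition colN (T : Type) p (M : 'M[T]_(p, n)) : 'M[T]_(p, #|~: B|) :=
  colsub nidx M.

Variable R : realType.
Implicit Types (A D : 'M[R]_(m, n)) (c : 'cV[R]_n) (lambda : R).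

Definition is_basis A : Prop := colB A \in unitmx.

Definition E_ A D : 'M[R]_m := invmx (colB A) *m colB D.

Definition reduced_costs A D c lambda : 'rV[R]_#|~: B| :=
  colN c^T - colB c^T *m invmx (colB A + lambda *: colB D)
                      *m (colN A + lambda *: colN D).

End LinearProgram.

Section Decompositions.
Variable (R : realType) (m : nat).
Implicit Types (E : 'M[R]_m) (Q S U : 'M[R[i]]_m).

Definition toC (p q : nat) (M : 'M[R]_(p, q)) : 'M[R[i]]_(p, q) :=
  map_mx (real_complex R) M.

Definition is_eigendecomposition E Q S : Prop :=
  [/\ Q \in unitmx, is_diag_mx S & toC E = Q *m S *m invmx Q].

(* [is_trig_mx] is lower triangularity, hence the transpose. *)
Definition is_schur_decomposition E Q U : Prop :=
  [/\ Q \is unitarymx, is_trig_mx U^T & toC E = Q *m U *m Q ^t*].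

End Decompositions.

(* The input of the preprocessing: the data of the linear program, the inverse
   of the basis matrix, and the three factors [F1], [F2], [F3] of a
   decomposition.  Nothing here depends on lambda. *)
Definition preprocessing_input (R : realType) (m n : nat) (B : {set 'I_n})
    (hB : #|B| = m) (A D : 'M[R]_(m, n)) (b : 'cV[R]_m) (c : 'cV[R]_n)
    (F1 F2 F3 : 'M[R[i]]_m) : seq R[i] :=
  entries (toC A) ++ entries (toC D) ++ entries (toC b) ++ entries (toC c)
  ++ entries (toC (invmx (colB hB A)))
  ++ entries F1 ++ entries F2 ++ entries F3.

(* [pre] is run once on [inp]; its result [w] then serves all values of
   lambda, for which [main] only reads [w] and lambda. *)
Definition computes_reduced_costs (R : realType) (m n : nat) (B : {set 'I_n})
    (hB : #|B| = m) (A D : 'M[R]_(m, n)) (c : 'cV[R]_n)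
    (pre main : slp) (inp : seq R[i]) : Prop :=
  exists2 w : seq R[i], run pre inp = Some w &
    forall lambda : R, colB hB A + lambda *: colB hB D \in unitmx ->
      run main (rcons w lambda%:C)
        = Some (entries (toC (reduced_costs hB A D c lambda))).

(* Main.v *)
Require Import Defs.
From mathcomp Require Import all_boot all_order all_algebra.
From mathcomp Require Import reals.
From mathcomp Require Import complex.
From mathcomp Require Import zify ring.

Set Implicit Arguments.
Unset Strict Implicit.
Unset Printing Implicit Defensive.

Import GRing.Theory Num.Theory.
Local Open Scope ring_scope.
Local Open Scope complex_scope.
Local Open Scope sesquilinear_scope.

(** The idea is to change coordinates so that the basis matrix becomes
    triangular for every lambda at once.  Both decompositions have the form
    [E_B = F1 *m F2 *m F3] with [F1 *m F3 = 1%:M] and [F2] upper triangular: an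
    eigendecomposition has [F2] diagonal, and for a Schur decomposition [F3] is
    the conjugate transpose of the unitary factor.  Since
    [A_B + lambda D_B = A_B (1 + lambda E_B)], the inverse of the perturbed
    basis matrix is [F1 (1 + lambda F2)^-1 (F3 A_B^-1)]
    ([perturbed_inv_factored]), and hence ([reduced_costs_factored])
<<
      r(lambda) = c_N^T - y (G_A + lambda G_D),   y (1 + lambda F2) = c_B^T F1,
      G_A = F3 A_B^-1 A_N,   G_D = F3 A_B^-1 D_N.
>>
    The row [c_B^T F1] and the matrices [G_A], [G_D] do not depend on lambda:
    the preprocessing computes them.  Each new lambda then needs a triangular
    solve for [y], by forward substitution ([forward_substitution]) in at most
    [m * (2 * m + 4)] operations, and the subtraction of
    [y G_A + (lambda y) G_D] from [c_N^T], in [4 * m] operations for each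
    nonbasic column.  The divisors in the solve are the diagonal entries of
    [1 + lambda F2], which are nonzero because this matrix is invertible as
    soon as [A_B + lambda D_B] is ([trig_unitmx_diag], [kernel_mx_unit]).

    A program must be fixed before the data it runs on are known.  Programs are
    therefore built on a symbolic memory, a sequence of functions of the data,
    and [reach k Phi G] says that one code of length at most [k] leads, for all
    data, from the memory [Phi] to a memory satisfying [G].  The rules
    [reach_op], [reach_bind] and [reach_ord] compose such statements as in a
    program logic, with the costs adding up; registers are referred to by the
    quantity that they hold, never by their address. *)

(** * Straight-line programs on a symbolic memory *)

Section SymbolicMemory.
Variables (F : fieldType) (X : Type).
Implicit Types (x : X) (f g h : X -> F) (Phi Psi : seq (X -> F)) (k l : nat).
Implicit Types (G H : seq (X -> F) -> Prop).

Definition contents Phi x : seq F := [seq f x | f <- Phi].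

Definition stored Phi f : Prop :=
  exists2 k, (k < size Phi)%N & forall x, nth (fun=> 0) Phi k x = f x.

Definition stored_mx Phi p q (M : X -> 'M[F]_(p, q)) : Prop :=
  forall i j, stored Phi (fun x => M x i j).

Definition keeps Phi Psi : Prop := forall f, stored Phi f -> stored Psi f.

(** The code is chosen before the data [x]: this is the uniformity that the
    existence of a single program demands. *)
Definition reach k Phi G : Prop :=
  exists Psi, [/\ exists2 p, (size p <= k)%N &
                    forall x, exec p (contents Phi x) = Some (contents Psi x),
                  keeps Phi Psi & G Psi].

Lemma stored_ext Phi f g : f =1 g -> stored Phi f -> stored Phi g.
Proof. by move=> fg [k lt_k Ek]; exists k => // x; rewrite Ek fg. Qed.

Lemma stored_catl Phi Psi f : stored Phi f -> stored (Phi ++ Psi) f.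
Proof.
move=> [k lt_k Ek]; exists k => [|x]; first by rewrite size_cat ltn_addr.
by rewrite nth_cat lt_k.
Qed.

Lemma stored_catr Phi Psi f : stored Psi f -> stored (Phi ++ Psi) f.
Proof.
move=> [k lt_k Ek]; exists (size Phi + k)%N => [|x].
  by rewrite size_cat ltn_add2l.
by rewrite nth_cat ltnNge leq_addr addKn.
Qed.

Lemma stored_map (T : eqType) (s : seq T) (h : T -> X -> F) t :
  t \in s -> stored [seq h t | t <- s] (h t).
Proof.
move=> s_t; exists (index t s) => [|x]; first by rewrite size_map index_mem.
by rewrite (nth_map t) ?index_mem// nth_index.
Qed.

Lemma reach_ret Phi G : G Phi -> reach 0 Phi G.
Proof. by move=> GPhi; exists Phi; split=> //; exists [::]. Qed.

Lemma reach_weaken k l Phi G H :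
  (k <= l)%N -> (forall Psi, G Psi -> H Psi) -> reach k Phi G -> reach l Phi H.
Proof.
move=> le_kl GH [Psi [[p le_p Ep] kPP GPsi]]; exists Psi; split; auto.
by exists p => //; apply: leq_trans le_kl.
Qed.

Lemma reach_bind k l Phi G H :
    reach k Phi G ->
    (forall Psi, keeps Phi Psi -> G Psi -> reach l Psi H) ->
  reach (k + l) Phi H.
Proof.
move=> [Psi [[p le_p Ep] kPP GPsi]] /(_ Psi kPP GPsi).
move=> [Xi [[q le_q Eq] kPX HXi]]; exists Xi; split=> // [|f /kPP/kPX //].
exists (p ++ q) => [|x]; first by rewrite size_cat leq_add.
by rewrite /exec foldl_cat -/(exec p _) Ep; apply: Eq.
Qed.

Lemma reach_step i h Phi :
    (forall x, step (contents Phi x) i = Some (rcons (contents Phi x) (h x))) ->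
  reach 1 Phi (stored^~ h).
Proof.
move=> Ei; exists (Phi ++ [:: h]); split.
- exists [:: i] => // x.
  by rewrite /exec /= Ei /contents map_cat cats1.
- by move=> f; apply: stored_catl.
- by apply: stored_catr; exists 0%N.
Qed.

Lemma reach_const (z : int) Phi : reach 1 Phi (stored^~ (fun=> z%:~R)).
Proof. exact: (@reach_step (Const z)). Qed.

Lemma reach_op o Phi f g h :
    stored Phi f -> stored Phi g ->
    (forall x, eval_op o (f x) (g x) = Some (h x)) ->
  reach 1 Phi (stored^~ h).
Proof.
move=> [j lt_j Ej] [k lt_k Ek] Eo; apply: (@reach_step (Arith o j k)) => x.
rewrite /step !size_map lt_j lt_k /= !(nth_map (fun=> 0))//.
by rewrite Ej Ek Eo.
Qed.

(** Starting the accumulation from [f] rather than from zero means that no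
    constant has to be loaded and that an empty sum is free, so that a problem
    without constraints is handled at cost zero. *)
Lemma reach_sub_dot (I : eqType) (s : seq I) (b c : I -> X -> F) f Phi :
    stored Phi f ->
    {in s, forall i, stored Phi (b i)} -> {in s, forall i, stored Phi (c i)} ->
  reach (2 * size s) Phi
    (stored^~ (fun x => f x - \sum_(i <- s) b i x * c i x)).
Proof.
elim: s f Phi => [|i s IHs] f Phi sf sb sc.
  by apply: reach_ret; apply: stored_ext sf => x; rewrite big_nil subr0.
have -> : (2 * size (i :: s) = 1 + (1 + 2 * size s))%N by rewrite /=; lia.
have sI j : j \in s -> j \in i :: s by rewrite inE orbC => ->.
apply: (reach_bind (reach_op (o := OMul) (h := fun x => b i x * c i x)
          (sb _ (mem_head _ _)) (sc _ (mem_head _ _)) _)) => // Psi k1 st.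
apply: (reach_bind (reach_op (o := OSub) (h := fun x => f x - b i x * c i x)
          (k1 _ sf) st _)) => // Xi k2 su.
apply: reach_weaken (IHs _ Xi su _ _) => //.
- by move=> Om; apply: stored_ext => x; rewrite big_cons opprD addrA.
- by move=> j /sI /sb /k1 /k2.
- by move=> j /sI /sc /k1 /k2.
Qed.

(** The rule for loops: the body may rely on the results of earlier passes.
    Stability of [G] under extension of the memory is what lets these results
    survive the later passes. *)
Lemma reach_ord k l (G : 'I_l -> seq (X -> F) -> Prop) Phi :
    (forall (i : 'I_l) Psi Xi, keeps Psi Xi -> G i Psi -> G i Xi) ->
    (forall (i : 'I_l) Psi, keeps Phi Psi ->
       (forall i' : 'I_l, (i' < i)%N -> G i' Psi) -> reach k Psi (G i)) ->
  reach (l * k) Phi (fun Psi => forall i, G i Psi).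
Proof.
move=> G_stable G_step.
suff main t : (t <= l)%N ->
    reach (t * k) Phi (fun Psi => keeps Phi Psi /\
                                  forall i : 'I_l, (i < t)%N -> G i Psi).
  by apply: reach_weaken (main l _) => // Psi [_ GPsi] i; apply: GPsi.
elim: t => [|t IHt] lt_tl; first by apply: reach_ret; split.
rewrite mulSn addnC; apply: (reach_bind (IHt (ltnW lt_tl))).
move=> Psi _ [kPP GPsi].
rewrite -[k]addn0; apply: (reach_bind (G_step (Ordinal lt_tl) Psi kPP GPsi)).
move=> Xi kPX GXi; apply: reach_ret; split=> [f /kPP/kPX //|i].
rewrite ltnS leq_eqVlt => /predU1P[ti|/GPsi/(G_stable _ _ _ kPX)//].
by have -> : i = Ordinal lt_tl by apply: val_inj.
Qed.

Lemma reach_mx k p q (M : X -> 'M[F]_(p, q)) Phi :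
    (forall i j Psi, keeps Phi Psi ->
       reach k Psi (stored^~ (fun x => M x i j))) ->
  reach (p * (q * k)) Phi (fun Psi => stored_mx Psi M).
Proof.
move=> M_step; apply: reach_ord => [i Psi Xi kPX sM j|i Psi kP _].
  exact: kPX.
apply: reach_ord => [j Xi Om kXO|j Xi kX _]; first exact: kXO.
by apply: M_step => f /kP/kX.
Qed.

Lemma reach_mulmx p q r (M : X -> 'M[F]_(p, q)) (N : X -> 'M[F]_(q, r)) Phi :
    stored_mx Phi M -> stored_mx Phi N ->
  reach (p * (r * (1 + (2 * q + 1)))) Phi
    (fun Psi => stored_mx Psi (fun x => M x *m N x)).
Proof.
move=> sM sN; apply: reach_mx => i j Psi kP.
(* Dot products are only ever subtracted, so the entry is computed as
   [0 - (0 - dot)]. *)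
apply: (reach_bind (reach_const 0 Psi)) => Psi0 k0 s0.
rewrite -[q in (2 * q)%N]size_enum_ord.
have dot := reach_sub_dot (s := enum 'I_q) (b := fun u x => M x i u)
  (c := fun u x => N x u j) s0 (in1W (fun u => k0 _ (kP _ (sM i u))))
  (in1W (fun u => k0 _ (kP _ (sN u j)))).
apply: (reach_bind dot) => Psi1 k1 s1.
apply: (reach_op (o := OSub) (k1 _ s0) s1) => x.
by rewrite /= !sub0r opprK mxE big_enum.
Qed.

Lemma stored_read (T : Type) (s : seq T) (h : T -> X -> F) Phi :
    (forall t, stored Phi (h t)) ->
  exists2 ks, all (fun k => (k < size Phi)%N) ks &
    forall x, [seq (contents Phi x)`_k | k <- ks] = [seq h t x | t <- s].
Proof.
move=> sh; elim: s => [|t s [ks lt_ks Eks]]; first by exists [::].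
have [k lt_k Ek] := sh t; exists (k :: ks) => [|x] /=; first by rewrite lt_k.
by rewrite Eks (nth_map (fun=> 0))// Ek.
Qed.

Definition sym_entries p q (M : X -> 'M[F]_(p, q)) : seq (X -> F) :=
  [seq (fun x => M x ij.1 ij.2)
     | ij <- [seq (i, j) | i <- enum 'I_p, j <- enum 'I_q]].

Lemma contents_sym_entries p q (M : X -> 'M[F]_(p, q)) x :
  contents (sym_entries M) x = entries (M x).
Proof. by rewrite /contents -map_comp map_allpairs. Qed.

Lemma stored_sym_entries p q (M : X -> 'M[F]_(p, q)) :
  stored_mx (sym_entries M) M.
Proof.
move=> i j; apply: (stored_map (fun ij x => M x ij.1 ij.2) (t := (i, j))).
by apply: allpairs_f; rewrite mem_enum.
Qed.

Lemma stored_mx_read p q (M : X -> 'M[F]_(p, q)) Phi : stored_mx Phi M ->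
  exists2 ks, all (fun k => (k < size Phi)%N) ks &
    forall x, [seq (contents Phi x)`_k | k <- ks] = entries (M x).
Proof.
move=> sM; have [|ks lt_ks Eks] :=
    @stored_read _ [seq (i, j) | i <- enum 'I_p, j <- enum 'I_q]
      (fun ij x => M x ij.1 ij.2) Phi.
  by move=> ij; apply: sM.
by exists ks => // x; rewrite Eks map_allpairs.
Qed.

End SymbolicMemory.

Lemma stored_comp (F : fieldType) (X Y : Type) (g : Y -> X)
    (Phi : seq (X -> F)) f :
  stored Phi f -> stored [seq h \o g | h <- Phi] (f \o g).
Proof.
move=> [k lt_k Ek]; exists k => [|y]; first by rewrite size_map.
by rewrite (nth_map (fun=> 0))//= Ek.
Qed.

(** * Triangular systems *)

(** Column [j] of the system involves only the unknowns up to [j], so that it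
    determines [y 0 j] from the previous ones.  The products [lam * y 0 i] are
    grouped because the program keeps them for later use. *)
Lemma forward_substitution (F : fieldType) m (U : 'M[F]_m) (lam : F)
    (y v : 'rV[F]_m) (j : 'I_m) :
    is_trig_mx U^T -> y *m (1%:M + lam *: U) = v ->
  y 0 j * (lam * U j j + 1) =
    v 0 j - \sum_(i < m | (i < j)%N) lam * y 0 i * U i j.
Proof.
move=> /is_trig_mxP trigU <-; rewrite mulmxDr mulmx1 -scalemxAr !mxE.
under [X in _ - X]eq_bigr do rewrite -mulrA.
rewrite -mulr_sumr.
have -> : \sum_i y 0 i * U i j =
          \sum_(i < m | (i < j)%N) y 0 i * U i j + y 0 j * U j j.
  rewrite (bigID (fun i : 'I_m => (i < j)%N)) /=; congr (_ + _).
  rewrite (bigD1 j) ?ltnn//= big1 ?addr0// => i; rewrite -leqNgt.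
  move=> /andP[le_ji ne_ij]; have := trigU j i; rewrite !mxE => ->.
    by rewrite mulr0.
  by rewrite ltn_neqAle le_ji andbT eq_sym.
ring.
Qed.

(** The determinant of a triangular matrix is the product of its diagonal, so
    forward substitution divides by nonzero numbers only. *)
Lemma trig_unitmx_diag (F : fieldType) m (U : 'M[F]_m) (lam : F) (j : 'I_m) :
    is_trig_mx U^T -> 1%:M + lam *: U \in unitmx ->
  lam * U j j + 1 != 0.
Proof.
move=> /is_trig_mxP trigU; rewrite unitmxE -det_tr det_trig; last first.
  apply/is_trig_mxP => i i' lt_ii'.
  have := trigU i i' lt_ii'; rewrite !mxE => ->.
  by rewrite mulr0 addr0 -val_eqE /= gtn_eqF.
rewrite unitfE => /prodf_neq0 /(_ j isT).
by rewrite !mxE eqxx addrC.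
Qed.

(** * Factorization of the reduced costs *)

Section ReducedCosts.
Variables (R : realType) (m n : nat) (B : {set 'I_n}) (hB : #|B| = m).

Lemma colN_toC p (M : 'M[R]_(p, n)) : colN B (toC M) = toC (colN B M).
Proof. by apply/matrixP=> i j; rewrite !mxE. Qed.

Lemma colB_toC p (M : 'M[R]_(p, n)) : colB hB (toC M) = toC (colB hB M).
Proof. by apply/matrixP=> i j; rewrite !mxE. Qed.

(** The hypotheses are packed with the data because a program is only required
    to succeed on data that satisfy them; those on the factors hold for both
    kinds of decomposition. *)
Record lp_data := LpData {
  lhs : 'M[R]_(m, n); pert : 'M[R]_(m, n); rhs : 'cV[R]_m; obj : 'cV[R]_n;
  fac1 : 'M[R[i]]_m; fac2 : 'M[R[i]]_m; fac3 : 'M[R[i]]_m;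
  lhs_basis : is_basis hB lhs;
  fac13 : fac1 *m fac3 = 1%:M;
  fac2_trig : is_trig_mx fac2^T;
  facE : toC (E_ hB lhs pert) = fac1 *m fac2 *m fac3 }.

Record lp_param := LpParam {
  lp_of : lp_data; lam : R;
  lam_unit : colB hB (lhs lp_of) + lam *: colB hB (pert lp_of) \in unitmx }.

Definition basis_inv (d : lp_data) : 'M[R[i]]_m :=
  toC (invmx (colB hB (lhs d))).

Definition cost_row (d : lp_data) : 'rV[R[i]]_m :=
  colB hB (toC (obj d)^T) *m fac1 d.

(** Sends a right-hand side to the coordinates of its basic solution in a basis
    where [E_B] acts as the triangular matrix [fac2]. *)
Definition tri_coords (d : lp_data) : 'M[R[i]]_m := fac3 d *m basis_inv d.

Definition kernel_mx (t : lp_param) : 'M[R[i]]_m :=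
  1%:M + (lam t)%:C *: fac2 (lp_of t).

(** The row [c_B^T (1 + lambda E_B)^-1], in the coordinates where [E_B] is
    triangular. *)
Definition dual_row (t : lp_param) : 'rV[R[i]]_m :=
  cost_row (lp_of t) *m invmx (kernel_mx t).

Lemma basis_inv_unit d : basis_inv d \in unitmx.
Proof. by rewrite /basis_inv /toC map_unitmx unitmx_inv lhs_basis. Qed.

(** This is [A_B + lambda D_B = A_B (1 + lambda E_B)], with
    [1 + lambda E_B = fac1 (1 + lambda fac2) fac3] as [fac1] and [fac3] are
    inverse to each other. *)
Lemma perturbed_basis_factored (t : lp_param) :
  toC (colB hB (lhs (lp_of t)) + lam t *: colB hB (pert (lp_of t))) =
    invmx (basis_inv (lp_of t)) *m (fac1 (lp_of t) *m kernel_mx t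
                                    *m fac3 (lp_of t)).
Proof.
case: t => -[A D b c F1 F2 F3 /= uA F13 trigF FE] l ul; rewrite /kernel_mx /=.
rewrite /basis_inv /= mulmxDr mulmx1 mulmxDl F13 -scalemxAr -scalemxAl -FE.
rewrite /toC -map_invmx invmxK /E_ mulmxDr mulmx1 -scalemxAr -map_mxM.
by rewrite mulKVmx// map_mxD map_mxZ.
Qed.

Lemma kernel_mx_unit t : kernel_mx t \in unitmx.
Proof.
have := perturbed_basis_factored t.
have /mulmx1_unit[u1 u3] := fac13 (lp_of t).
move/(congr1 (fun M => M \in unitmx)); rewrite /toC map_unitmx lam_unit.
by rewrite !unitmx_mul => /esym /and3P[_ /andP[]].
Qed.

Lemma perturbed_inv_factored t (d := lp_of t) :
  toC (invmx (colB hB (lhs d) + lam t *: colB hB (pert d))) =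
    fac1 d *m invmx (kernel_mx t) *m tri_coords d.
Proof.
have F31 : fac3 d *m fac1 d = 1%:M by apply: mulmx1C; apply: fac13.
have uP : toC (colB hB (lhs d) + lam t *: colB hB (pert d)) \in unitmx.
  by rewrite /toC map_unitmx lam_unit.
rewrite /toC map_invmx -/(toC _); apply: (can_inj (mulKmx uP)).
rewrite mulmxV//.
rewrite perturbed_basis_factored /tri_coords -!mulmxA (mulmxA (fac3 d)) F31.
rewrite mul1mx (mulmxA (kernel_mx t)) mulmxV ?kernel_mx_unit// mul1mx.
by rewrite (mulmxA (fac1 d)) fac13 mul1mx mulVmx// basis_inv_unit.
Qed.

Lemma reduced_costs_factored t (d := lp_of t) :
  toC (reduced_costs hB (lhs d) (pert d) (obj d) (lam t)) =
    colN B (toC (obj d)^T)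
    - dual_row t *m (tri_coords d *m colN B (toC (lhs d))
                     + (lam t)%:C *: (tri_coords d *m colN B (toC (pert d)))).
Proof.
rewrite /reduced_costs /toC map_mxB !map_mxM -!/(toC _).
rewrite perturbed_inv_factored !colN_toC /dual_row /cost_row colB_toC.
rewrite scalemxAr -mulmxDr !mulmxA.
by rewrite /toC map_mxD map_mxZ.
Qed.

Lemma dual_row_solves t : dual_row t *m kernel_mx t = cost_row (lp_of t).
Proof. by rewrite mulmxKV ?kernel_mx_unit. Qed.

Definition nonbasic_lhs (d : lp_data) : 'M[R[i]]_(m, #|~: B|) :=
  tri_coords d *m colN B (toC (lhs d)).

Definition nonbasic_pert (d : lp_data) : 'M[R[i]]_(m, #|~: B|) :=
  tri_coords d *m colN B (toC (pert d)).

(** * The preprocessing *)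

(** What the program for a given lambda expects from the preprocessing.  The
    constant one is included because loading it would exceed the cost bound,
    which is zero, when [m = 0]. *)
Definition prepared (Phi : seq (lp_data -> R[i])) : Prop :=
  [/\ stored Phi (fun=> 1) /\ stored_mx Phi (fun d => toC (obj d)^T),
      stored_mx Phi cost_row, stored_mx Phi fac2,
      stored_mx Phi nonbasic_lhs & stored_mx Phi nonbasic_pert].

Definition sym_input : seq (lp_data -> R[i]) :=
  sym_entries (fun d => toC (lhs d)) ++ sym_entries (fun d => toC (pert d))
  ++ sym_entries (fun d => toC (rhs d)) ++ sym_entries (fun d => toC (obj d))
  ++ sym_entries basis_inv
  ++ sym_entries fac1 ++ sym_entries fac2 ++ sym_entries fac3.

Lemma contents_sym_input d :
  contents sym_input d =
    preprocessing_input hB (lhs d) (pert d) (rhs d) (obj d)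
      (fac1 d) (fac2 d) (fac3 d).
Proof.
by rewrite /contents !map_cat -!/(contents _ d) !contents_sym_entries.
Qed.

Lemma reach_prepared : exists k, reach k sym_input prepared.
Proof.
have sA : stored_mx sym_input (fun d => toC (lhs d)).
  by move=> i j; apply/stored_catl/stored_sym_entries.
have sD : stored_mx sym_input (fun d => toC (pert d)).
  by move=> i j; apply/stored_catr/stored_catl/stored_sym_entries.
have sc : stored_mx sym_input (fun d => toC (obj d)).
  move=> i j; do 3 apply: stored_catr; apply: stored_catl.
  exact: stored_sym_entries.
have sI : stored_mx sym_input basis_inv.
  by move=> i j; do 4 apply: stored_catr; apply/stored_catl/stored_sym_entries.
have s1 : stored_mx sym_input fac1.
  by move=> i j; do 5 apply: stored_catr; apply/stored_catl/stored_sym_entries.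
have s2 : stored_mx sym_input fac2.
  by move=> i j; do 6 apply: stored_catr; apply/stored_catl/stored_sym_entries.
have s3 : stored_mx sym_input fac3.
  by move=> i j; do 7 apply: stored_catr; apply: stored_sym_entries.
have scB : stored_mx sym_input (fun d => colB hB (toC (obj d)^T)).
  by move=> i j; apply: stored_ext (sc (bidx hB j) i) => d; rewrite !mxE.
eexists.
apply: (reach_bind (reach_const 1 _)) => P0 k0 h1.
apply: (reach_bind (reach_mulmx (fun i j => k0 _ (scB i j))
                                (fun i j => k0 _ (s1 i j)))) => P1 k01 hv.
have {k0 k01} k1 : keeps sym_input P1 /\ stored P1 (fun=> 1).
  by split=> [f /k0/k01//|]; apply/k01/h1.
case: k1 => k1 {}h1.
apply: (reach_bind (reach_mulmx (fun i j => k1 _ (s3 i j))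
                                (fun i j => k1 _ (sI i j)))) => P2 k12 hH.
have sAN : stored_mx P2 (fun d => colN B (toC (lhs d))).
  move=> i j; apply/k12/k1; apply: stored_ext (sA i (nidx j)) => d.
  by rewrite !mxE.
have sDN : stored_mx P2 (fun d => colN B (toC (pert d))).
  move=> i j; apply/k12/k1; apply: stored_ext (sD i (nidx j)) => d.
  by rewrite !mxE.
apply: (reach_bind (reach_mulmx hH sAN)) => P3 k23 hA.
apply: (reach_bind (reach_mulmx (fun i j => k23 _ (hH i j))
                                (fun i j => k23 _ (sDN i j)))) => P4 k34 hD.
have k14 : keeps P1 P4 by move=> f /k12/k23/k34.
apply: reach_ret; split=> //.
- by split=> [|i j]; [apply/k14 | apply: stored_ext (k14 _ (k1 _ (sc j i)))
    => d; rewrite !mxE].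
- by move=> i j; apply/k14/hv.
- by move=> i j; apply/k14/k1/s2.
- by move=> i j; apply/k34/hA.
Qed.

(** * The computation for a given lambda *)

Definition online_memory (Phi : seq (lp_data -> R[i])) :
    seq (lp_param -> R[i]) :=
  [seq h \o lp_of | h <- Phi] ++ [:: fun t => (lam t)%:C].

Lemma contents_online Phi t :
  contents (online_memory Phi) t = rcons (contents Phi (lp_of t)) (lam t)%:C.
Proof. by rewrite /contents map_cat -map_comp cats1. Qed.

Lemma stored_online Phi f :
  stored Phi f -> stored (online_memory Phi) (f \o lp_of).
Proof. by move=> sf; apply/stored_catl/stored_comp. Qed.

Lemma stored_lam Phi : stored (online_memory Phi) (fun t => (lam t)%:C).
Proof. by apply: stored_catr; exists 0%N. Qed.

(** Each pass costs at most [2 * m] operations for the sum, three for the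
    division by [1 + lam * U j j], with [U] the triangular factor, and one for
    the product of [lam] and the entry found, which both the next passes and
    the computation of the reduced costs use. *)
Lemma reach_dual_row Phi : prepared Phi ->
  reach (m * (2 * m + 4)) (online_memory Phi)
    (fun Psi => forall j, stored Psi (fun t => dual_row t 0 j) /\
       stored Psi (fun t => (lam t)%:C * dual_row t 0 j)).
Proof.
move=> [[h1 hc] hv hU hA hD]; apply: reach_ord => [j Psi Xi kPX|j Psi kP IHj].
  by case=> /kPX sy /kPX sz.
have sl : stored Psi (fun t => (lam t)%:C) by apply/kP/stored_lam.
have s1 : stored Psi (fun=> 1) by apply: (kP _ (stored_online h1)).
have sU i i' : stored Psi (fun t => fac2 (lp_of t) i i').
  by apply: (kP _ (stored_online (hU i i'))).
have sv : stored Psi (fun t => cost_row (lp_of t) 0 j).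
  by apply: (kP _ (stored_online (hv 0 j))).
pose s := [seq i : 'I_m <- enum 'I_m | (i < j)%N].
have size_s : (2 * size s <= 2 * m)%N.
  by rewrite leq_mul2l -[m in leqRHS]size_enum_ord size_filter count_size.
have dot : reach (2 * m) Psi ((@stored _ _)^~ (fun t => cost_row (lp_of t) 0 j -
    \sum_(i < m | (i < j)%N) (lam t)%:C * dual_row t 0 i
                             * fac2 (lp_of t) i j)).
  apply: reach_weaken size_s _ (reach_sub_dot (s := s)
    (b := fun i t => (lam t)%:C * dual_row t 0 i)
    (c := fun i t => fac2 (lp_of t) i j) sv _ _) => [Xi|i|i _].
  - by apply: stored_ext => t; rewrite big_filter big_enum_cond.
  - by rewrite mem_filter => /andP[/IHj[]].
  - exact: sU.
apply: (reach_bind dot) => P1 k1 sw.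
apply: (@reach_bind _ _ 1 3 _ _ _ (reach_op (o := OMul)
  (h := fun t => (lam t)%:C * fac2 (lp_of t) j j)
  (k1 _ sl) (k1 _ (sU j j)) _)) => // P2 k2 sd.
apply: (@reach_bind _ _ 1 2 _ _ _ (reach_op (o := OAdd)
  (h := fun t => (lam t)%:C * fac2 (lp_of t) j j + 1)
  sd (k2 _ (k1 _ s1)) _)) => // P3 k3 {}sd.
apply: (@reach_bind _ _ 1 1 _ _ _ (reach_op (o := ODiv)
  (h := fun t => dual_row t 0 j) (k3 _ (k2 _ sw)) sd _)) => [t|P4 k4 sy].
  have d0 := trig_unitmx_diag j (fac2_trig (lp_of t)) (kernel_mx_unit t).
  rewrite /= (negPf d0); congr Some; apply: (mulIf d0); rewrite divfK//.
  rewrite (forward_substitution j (fac2_trig (lp_of t)) (dual_row_solves t)).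
  by [].
apply: (@reach_bind _ _ 1 0 _ _ _ (reach_op (o := OMul)
  (h := fun t => (lam t)%:C * dual_row t 0 j)
  (k4 _ (k3 _ (k2 _ (k1 _ sl)))) sy _)) => // P5 k5 sz.
by apply: reach_ret; split=> //; apply: k5.
Qed.

(** Each nonbasic column is priced against [nonbasic_lhs] with the row
    [dual_row], then against [nonbasic_pert] with [lam] times this row, so that
    the matrix [nonbasic_lhs + lam * nonbasic_pert] is never formed. *)
Lemma reach_reduced_costs Phi : prepared Phi ->
  reach (m * (2 * m + 4) + #|~: B| * (2 * m + 2 * m)) (online_memory Phi)
    (fun Psi => stored_mx Psi (fun t =>
       toC (reduced_costs hB (lhs (lp_of t)) (pert (lp_of t)) (obj (lp_of t))
              (lam t)))).
Proof.
move=> prep; apply: (reach_bind (reach_dual_row prep)) => Psi kP syz.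
case: prep => [[h1 hc] hv hU hA hD].
rewrite -[X in reach X]mul1n; apply: reach_mx => i j Xi kX.
have sc : stored Xi (fun t => colN B (toC (obj (lp_of t))^T) 0 j).
  apply: kX; apply: stored_ext (kP _ (stored_online (hc 0 (nidx j)))) => t /=.
  by rewrite !mxE.
have sA u : stored Xi (fun t => nonbasic_lhs (lp_of t) u j).
  by apply/kX/kP/(stored_online (hA u j)).
have sD u : stored Xi (fun t => nonbasic_pert (lp_of t) u j).
  by apply/kX/kP/(stored_online (hD u j)).
have sy u : stored Xi (fun t => dual_row t 0 u) by case: (syz u) => /kX.
have sz u : stored Xi (fun t => (lam t)%:C * dual_row t 0 u).
  by case: (syz u) => _ /kX.
have size_m : size (enum 'I_m) = m by rewrite size_enum_ord.
have := reach_sub_dot (s := enum 'I_m) sc (in1W sy) (in1W sA).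
rewrite size_m => dotA.
apply: (reach_bind dotA) => P1 k1 sw.
have := reach_sub_dot (s := enum 'I_m) sw (in1W (fun u => k1 _ (sz u)))
  (in1W (fun u => k1 _ (sD u))).
rewrite size_m; apply: reach_weaken => // P2; apply: stored_ext => t.
rewrite reduced_costs_factored !big_enum ord1 mulmxDr -scalemxAr !mxE.
rewrite opprD addrA mulr_sumr; congr (_ - _).
by apply: eq_bigr => u _; rewrite mulrA.
Qed.

End ReducedCosts.

(** * The two decompositions *)

(** The preprocessing hands over its whole memory, so that every quantity stored
    by the preprocessing is at the disposal of the second program. *)
Lemma triangular_program (R : realType) (m n : nat) (B : {set 'I_n})
    (hB : #|B| = m) :
  exists pre main : slp, (cost main <= 6 * (m ^ 2 + m * n))%N /\
    forall (A D : 'M[R]_(m, n)) (b : 'cV[R]_m) (c : 'cV[R]_n)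
           (F1 F2 F3 : 'M[R[i]]_m),
      is_basis hB A -> F1 *m F3 = 1%:M -> is_trig_mx F2^T ->
      toC (E_ hB A D) = F1 *m F2 *m F3 ->
    computes_reduced_costs hB A D c pre main
      (preprocessing_input hB A D b c F1 F2 F3).
Proof.
have [_ [Phi [[p _ Ep] _ prep]]] := reach_prepared R hB.
have [Psi [[q le_q Eq] _ /stored_mx_read[ks lt_ks Eks]]] :=
  reach_reduced_costs prep.
(* The constant 6 comes from [2 m^2 + 4 m <= 6 m^2] for the substitution and
   [4 m] for each of the at most [n] nonbasic columns. *)
exists (Slp p (iota 0 (size Phi))), (Slp q ks); split=> [|A D b c F1 F2 F3].
  apply: leq_trans le_q _.
  have le_N : (#|~: B| <= n)%N by rewrite -[leqRHS]card_ord max_card.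
  have le_m : (m <= m ^ 2)%N by rewrite -mulnn; nia.
  have := leq_mul (leqnn m) le_N; nia.
move=> uA F13 trigF FE; pose d := LpData b c uA F13 trigF FE.
exists (contents Phi d) => [|l ul].
  have -> : preprocessing_input hB A D b c F1 F2 F3 =
            contents (sym_input R hB) d by rewrite contents_sym_input.
  rewrite /run Ep /= size_map.
  have -> : all (fun k => k < size Phi)%N (iota 0 (size Phi)).
    by apply/allP => k; rewrite mem_iota.
  have := map_nth_iota0 0 (leqnn (size (contents Phi d))).
  by rewrite take_size size_map => ->.
pose t := @LpParam _ _ _ _ hB d l ul.
have -> : rcons (contents Phi d) l%:C = contents (online_memory Phi) t.
  by rewrite contents_online.
by rewrite /run Eq /= size_map lt_ks Eks.
Qed.

Theorem theorem7 (R : realType) :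
  exists K : nat,
  forall (m n : nat) (B : {set 'I_n}) (hB : #|B| = m),
    (exists pre main : slp,
       (cost main <= K * (m ^ 2 + m * n))%N /\
       forall (A D : 'M[R]_(m, n)) (b : 'cV[R]_m) (c : 'cV[R]_n)
              (Q S : 'M[R[i]]_m),
         is_basis hB A ->
         is_eigendecomposition (E_ hB A D) Q S ->
         computes_reduced_costs hB A D c pre main
           (preprocessing_input hB A D b c Q S (invmx Q)))
    /\
    (exists pre main : slp,
       (cost main <= K * (m ^ 2 + m * n))%N /\
       forall (A D : 'M[R]_(m, n)) (b : 'cV[R]_m) (c : 'cV[R]_n)
              (Q U : 'M[R[i]]_m),
         is_basis hB A ->
         is_schur_decomposition (E_ hB A D) Q U ->
         computes_reduced_costs hB A D c pre main
           (preprocessing_input hB A D b c Q U (Q ^t*))).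
Proof.
exists 6%N => m n B hB.
have [pre [main [cost_main correct]]] := triangular_program R hB.
split; exists pre, main; split=> // A D b c Q S uA.
  case=> uQ diagS ES; apply: correct => //; first exact: mulmxV.
  by apply: is_diag_mx_is_trig; rewrite is_diag_trmx.
by case=> /unitarymxP QQ trigS ES; apply: correct.
Qed.
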